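(* Let $G$ and $H$ be \textsc{Nim} positions with $G\equiv H$ (impartial mis\`ere equivalence, i.e. $o^{-}(G+X)=o^{-}(H+X)$ for all impartial games $X$). Then the reduced form of $G$ is isomorphic to the reduced form of $H$.
   Context: All games are short: they have finitely many distinct subpositions and admit no infinite runs. A game is impartial if in every subposition both players have the same options; an impartial game is given by its set of options (several moves leading to isomorphic positions are not distinguished). $G\cong H$ (isomorphic) means that the game trees are isomorphic. $G+H$ is the disjunctive sum: a player moves in exactly one of the components. Play is mis\`ere: a player who has no move on their turn wins. $o^{-}(G)$ is the mis\`ere outcome of $G$; for impartial $G$ it is $\mathcal{P}$ or $\mathcal{N}$ according to whether the Previous (second) or the Next (first) player has a winning strategy. $G\equiv H$ means $o^{-}(G+X)=o^{-}(H+X)$ for all impartial games $X$. A Nim heap of size $n$ (a natural number) is the impartial game whose options are the Nim heaps of size $m$ with $0\le m<n$. A \textsc{Nim} position is a disjunctive sum of finitely many Nim heaps. Every \textsc{Nim} position is determined up to isomorphism by the multiset of its nonzero heap sizes, and is identified (up to isomorphism) with the finite nondecreasing sequence of its positive heap sizes; the empty sequence $(\cdot)$ corresponds to the zero position. The reduced form of a \textsc{Nim} position is obtained by performing the following steps in order: (i) If there are at least two odd-sized heaps, replace the lowest pair of them with heaps of size one less; repeat this until there is at most one odd-sized heap. (ii) If there is an odd-sized heap, and it is not the largest heap, replace the odd-sized heap with a heap of size one less and replace one of the largest heaps with a heap of size one greater. (iii) Delete all empty heaps. *)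

(* Defs.v *)
From mathcomp Require Import all_boot.

Set Implicit Arguments.
Unset Strict Implicit.
Unset Printing Implicit Defensive.

(* A short impartial game is a finitely branching, well-founded tree of
   options.  The list of options stands for a set: order and repetitions are
   forgotten by [game_iso]. *)
Inductive game : Type := Game of seq game.

Definition options (G : game) : seq game := let: Game s := G in s.

Definition zero_game : game := Game [::].

(* Moves to isomorphic positions are not distinguished, so an isomorphism of
   game trees matches the sets of options up to isomorphism: this is
   hereditary equality of the sets of options. *)
Fixpoint game_iso (G H : game) {struct G} : bool :=
  let: Game s := G in
  all (fun G' => has (game_iso G') (options H)) s &&
  all (fun H' => has (fun G' => game_iso G' H') s) (options H).

Fixpoint game_add (G : game) : game -> game :=
  let: Game s := G in
  fix game_add_G (H : game) : game :=
    let: Game t := H in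
    Game ([seq game_add G' H | G' <- s] ++ [seq game_add_G H' | H' <- t]).

Lemma options_game_add (G H : game) :
  options (game_add G H) =
    [seq game_add G' H | G' <- options G] ++
    [seq game_add G H' | H' <- options H].
Proof. by case: G => s; case: H. Qed.

Inductive outcome : Set := OutcomeP | OutcomeN.

(* Under misere play the player to move wins when there is no move. *)
Fixpoint misere_next_wins (G : game) : bool :=
  let: Game s := G in
  nilp s || has (fun G' => ~~ misere_next_wins G') s.

Definition misere_outcome (G : game) : outcome :=
  if misere_next_wins G then OutcomeN else OutcomeP.

Definition misere_equiv (G H : game) : Prop :=
  forall X : game,
    misere_outcome (game_add G X) = misere_outcome (game_add H X).

Fixpoint nim_heap_options (n : nat) : seq game :=
  if n is m.+1 then rcons (nim_heap_options m) (Game (nim_heap_options m))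
  else [::].

Definition nim_heap (n : nat) : game := Game (nim_heap_options n).

Lemma options_nim_heap (n : nat) :
  options (nim_heap n) = [seq nim_heap m | m <- iota 0 n].
Proof.
rewrite /nim_heap /=; elim: n => [//|n IHn].
by rewrite -addn1 iotaD map_cat -IHn addn1 /= cats1 add0n.
Qed.

(* A Nim position is given by its heap sizes, in any order; empty heaps are
   allowed. *)
Definition nim_position (s : seq nat) : game :=
  foldr (fun n => game_add (nim_heap n)) zero_game s.

Definition lower_odd_pair (s : seq nat) : seq nat :=
  if sort leq (filter odd s) is [:: a, b & _]
  then [:: a.-1, b.-1 & rem b (rem a s)] else s.

(* [lower_odd_pair] is the identity once at most one odd heap is left, and
   otherwise makes two odd heaps even, so [count odd s] rounds suffice. *)
Definition lower_odd_pairs (s : seq nat) : seq nat :=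
  iter (count odd s) lower_odd_pair s.

(* Only meant for an [s] with at most one odd heap. *)
Definition shift_odd_heap (s : seq nat) : seq nat :=
  let m := \max_(n <- s) n in
  if filter odd s is a :: _
  then if a < m then [:: a.-1, m.+1 & rem m (rem a s)] else s
  else s.

Definition nim_reduced_form (s : seq nat) : seq nat :=
  [seq n <- shift_odd_heap (lower_odd_pairs s) | 0 < n].

(* Main.v *)
Require Import Defs.
From HB Require Import structures.
From mathcomp Require Import all_boot zify.

(* The key of a Nim position is the multiset of its positive halved heap sizes
   together with the parity of its total size.  The key determines the reduced
   form up to order: lowering two odd heaps, or moving the odd unit onto the
   largest heap, keeps it.  Equal keys give equivalent positions, because a move
   that has no counterpart on the other side is the lowering of an odd heap and
   is reversed by lowering a second one.

   Conversely, positions with different keys are distinguished.  By Conway's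
   theorem on linked games (built from mates), if [s] and [t] are not
   distinguished then each option of one is equivalent to an option of the other
   or has an option equivalent to that other.  By induction on the total size,
   with both positions replaced by ones having at most one odd heap, these
   equivalences are equalities of keys, and comparing multisets of halved heaps
   then forces the keys of [s] and [t] to agree.  The only exception is 2 + 2
   against 0, and these have different outcomes. *)

Set Implicit Arguments.
Unset Strict Implicit.
Unset Printing Implicit Defensive.

(** * Decidable equality and induction on games *)

Fixpoint game_tree (G : game) : GenTree.tree unit :=
  let: Game s := G in GenTree.Node 0 (map game_tree s).

Fixpoint tree_game (t : GenTree.tree unit) : game :=
  if t is GenTree.Node _ s then Game (map tree_game s) else zero_game.

Lemma game_treeK : cancel game_tree tree_game.
Proof.
rewrite /cancel; fix IH 1; case=> s /=; congr Game.
by elim: s => [//|G s IHs] /=; rewrite IH IHs.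
Qed.

HB.instance Definition _ := Equality.copy game (can_type game_treeK).

Lemma game_options_ind (P : game -> Prop) :
  (forall G, (forall G', G' \in options G -> P G') -> P G) -> forall G, P G.
Proof.
move=> step.
(* The hypothesis on the options is a [foldr] conjunction instead of a membership statement, so that
   the nested recursion below builds it structurally. *)
have {}step s : foldr (fun G => and (P G)) True s -> P (Game s).
  move=> Ps; apply: step => /= G'; elim: s Ps => [//|G s IHs] /= [PG Ps].
  by rewrite inE => /orP[/eqP->|] //; exact: IHs.
by fix IH 1; case=> s; apply: step; elim: s => [|G s IHs] /=.
Qed.

(** * Misère outcomes of sums *)

Lemma misere_next_winsE (G : game) :
  misere_next_wins G =
  nilp (options G) || has (fun G' => ~~ misere_next_wins G') (options G).
Proof. by case: G. Qed.

Lemma misere_next_wins_add (G H : game) :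
  misere_next_wins (game_add G H) =
  [|| nilp (options G) && nilp (options H),
      has (fun G' => ~~ misere_next_wins (game_add G' H)) (options G)
    | has (fun H' => ~~ misere_next_wins (game_add G H')) (options H)].
Proof.
rewrite misere_next_winsE options_game_add has_cat !has_map /nilp size_cat.
by rewrite !size_map addn_eq0.
Qed.

Lemma next_wins_addl (G G' H : game) :
  G' \in options G -> ~~ misere_next_wins (game_add G' H) ->
  misere_next_wins (game_add G H).
Proof.
move=> G'G losing; rewrite misere_next_wins_add; apply/or3P/Or32.
by apply/hasP; exists G'.
Qed.

Lemma next_wins_addr (G H H' : game) :
  H' \in options H -> ~~ misere_next_wins (game_add G H') ->
  misere_next_wins (game_add G H).
Proof.
move=> H'H losing; rewrite misere_next_wins_add; apply/or3P/Or33.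
by apply/hasP; exists H'.
Qed.

Lemma next_loses_add (G H : game) :
  ~~ (nilp (options G) && nilp (options H)) ->
  (forall G', G' \in options G -> misere_next_wins (game_add G' H)) ->
  (forall H', H' \in options H -> misere_next_wins (game_add G H')) ->
  ~~ misere_next_wins (game_add G H).
Proof.
move=> nonterm winl winr; rewrite misere_next_wins_add (negPf nonterm) /=.
by rewrite negb_or; apply/andP; split; apply/hasPn => X /[dup] XG;
  [move/winl | move/winr]; rewrite negbK.
Qed.

(** * Mates and linked games *)

Fixpoint mate (G : game) : game :=
  let: Game s := G in if s is [::] then nim_heap 1 else Game (map mate s).

(** The second player answers each move by the corresponding move in the other component. Play ends
    at zero plus a heap of size one, where the player to move must take the last move and so
    loses. *)
Lemma next_loses_add_mate (G : game) : ~~ misere_next_wins (game_add G (mate G)).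
Proof.
elim/game_options_ind: G => -[[|G0 s]] IH //.
apply: next_loses_add => // [G' G'G|H' H'm].
  apply: (next_wins_addr (H' := mate G')); last exact: IH.
  exact: (map_f mate G'G).
have /mapP[G' G'G ->] : H' \in map mate (G0 :: s) by [].
by apply: (next_wins_addl (G' := G')) => //; exact: IH.
Qed.

Definition distinguished (G H : game) : Prop :=
  exists X, misere_next_wins (game_add G X) != misere_next_wins (game_add H X).

Definition linked (G H : game) : Prop :=
  exists2 X, ~~ misere_next_wins (game_add G X) & ~~ misere_next_wins (game_add H X).

Lemma distinguished_sym (G H : game) : distinguished G H -> distinguished H G.
Proof. by case=> X; rewrite eq_sym; exists X. Qed.

(* A distinguishing [T] with the wrong orientation is repaired by adding the
   mates of the options of [G] to the option [T]. *)
Lemma distinguished_oriented (G H : game) : distinguished G H ->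
  exists2 X, ~~ misere_next_wins (game_add G X) & misere_next_wins (game_add H X).
Proof.
case=> T; case wG: (misere_next_wins (game_add G T)); last first.
  by move=> wH; exists T; [rewrite wG | case: misere_next_wins wH].
case wH: (misere_next_wins (game_add H T)) => // _.
exists (Game (T :: map mate (options G))); last first.
  by apply: (next_wins_addr (H' := T)); rewrite /= ?mem_head ?wH.
apply: next_loses_add => [|G' G'G|X /=]; first by rewrite /= andbF.
  apply: (next_wins_addr (H' := mate G')); last exact: next_loses_add_mate.
  by rewrite /= inE map_f ?orbT.
rewrite inE => /orP[/eqP-> //|/mapP[G' G'G ->]].
exact: next_wins_addl G'G (next_loses_add_mate _).
Qed.

(** Pools one oriented test per element of [s]. Every test kept is lost with some element of [s], so
    a move to that test can be punished. *)
Lemma collect_tests (s : seq game) (H : game) :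
  (forall G, G \in s -> distinguished G H) ->
  exists2 xs : seq game,
    (forall G, G \in s ->
      exists2 X, X \in xs & ~~ misere_next_wins (game_add G X)) &
    (forall X, X \in xs -> misere_next_wins (game_add H X) /\
      exists2 G, G \in s & ~~ misere_next_wins (game_add G X)).
Proof.
elim: s => [|G s IHs] dist; first by exists [::].
have [xs xsP xsN] : exists2 xs : seq game,
    (forall G, G \in s ->
      exists2 X, X \in xs & ~~ misere_next_wins (game_add G X)) &
    (forall X, X \in xs -> misere_next_wins (game_add H X) /\
      exists2 G, G \in s & ~~ misere_next_wins (game_add G X)).
  by apply: IHs => G' G's; apply: dist; rewrite inE G's orbT.
have [X GX HX] := distinguished_oriented (dist G (mem_head _ _)).
exists (X :: xs) => [G'|X']; rewrite inE => /orP[/eqP->|].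
- by exists X; rewrite ?mem_head.
- by case/xsP=> X' X'xs; exists X'; rewrite // inE X'xs orbT.
- by split=> //; exists G; rewrite ?mem_head.
- by case/xsN=> HX' [G' G's]; split=> //; exists G'; rewrite // inE G's orbT.
Qed.

(** The linking game has all collected tests as options. In its sum with [G], a move to an option of
    [G] is answered by a test from [xs], a test from [xs] by an option of [G] that loses with it,
    and a test from [ys] leaves a sum won by the next player; [H] is symmetric. *)
Lemma linked_if_distinguished (G H : game) :
  (forall G', G' \in options G -> distinguished G' H) ->
  (forall H', H' \in options H -> distinguished H' G) -> linked G H.
Proof.
move=> /collect_tests[xs xsP xsN] /collect_tests[ys ysP ysN].
(* Without tests neither game has an option, and a heap of size one links them. *)
case ns: (nilp (xs ++ ys)).
  have /andP[/nilP xs0 /nilP ys0] : nilp xs && nilp ys.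
    by move: ns; rewrite /nilp size_cat addn_eq0.
  have G0 : options G = [::].
    case Go: (options G) xsP => [//|G' s] /(_ G' (mem_head _ _))[X].
    by rewrite xs0.
  have H0 : options H = [::].
    case Ho: (options H) ysP => [//|H' s] /(_ H' (mem_head _ _))[X].
    by rewrite ys0.
  by case: G H G0 H0 {xsP xsN ysP ysN} => _ [_] /= -> ->; exists (nim_heap 1).
exists (Game (xs ++ ys)); apply: next_loses_add => [|K' K'K|X];
  rewrite /= ?ns ?andbF //.
- have [X Xxs KX] := xsP _ K'K.
  by apply: (next_wins_addr (H' := X)); rewrite //= mem_cat Xxs.
- rewrite mem_cat => /orP[/xsN[_ [K' K'K KX]]|/ysN[]//].
  exact: next_wins_addl K'K KX.
- have [X Xys KX] := ysP _ K'K.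
  by apply: (next_wins_addr (H' := X)); rewrite //= mem_cat Xys orbT.
- rewrite mem_cat => /orP[/xsN[]//|/ysN[_ [K' K'K KX]]].
  exact: next_wins_addl K'K KX.
Qed.

Lemma linked_option_distinguished (G H H' : game) :
  H' \in options H -> linked G H' -> distinguished G H.
Proof.
move=> H'H [X GX HX]; exists X.
by rewrite (negPf GX) (next_wins_addl H'H HX).
Qed.

Lemma misere_equiv_not_distinguished (G H : game) : misere_equiv G H ->
  ~ distinguished G H.
Proof.
move=> eqGH [X]; have := eqGH X; rewrite /misere_outcome.
by do 2!case: misere_next_wins.
Qed.

(** * Nim moves on lists of heap sizes *)

Lemma perm_cons2 (T : eqType) (x y : T) (s : seq T) :
  perm_eq [:: x, y & s] [:: y, x & s].
Proof. exact: permEl (perm_catCA [:: x] [:: y] s). Qed.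

Fixpoint moves (s : seq nat) : seq (seq nat) :=
  if s is n :: s' then
    [seq m :: s' | m <- iota 0 n] ++ [seq n :: t | t <- moves s']
  else [::].

Lemma options_nim_position (s : seq nat) :
  options (nim_position s) = [seq nim_position t | t <- moves s].
Proof.
elim: s => [//|n s IHs]; rewrite [LHS](options_game_add (nim_heap n)).
by rewrite options_nim_heap IHs /= map_cat -!map_comp.
Qed.

Lemma nim_optionP (s : seq nat) (G : game) :
  reflect (exists2 t, t \in moves s & G = nim_position t)
          (G \in options (nim_position s)).
Proof. by rewrite options_nim_position; apply: mapP. Qed.

Lemma nim_optionT (s t : seq nat) :
  t \in moves s -> nim_position t \in options (nim_position s).
Proof. by move=> st; apply/nim_optionP; exists t. Qed.

Lemma moves_perm_cons (s t : seq nat) : t \in moves s ->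
  exists n m r, [/\ m < n, perm_eq s (n :: r) & perm_eq t (m :: r)].
Proof.
elim: s t => [//|k s IHs] t /=; rewrite mem_cat.
case/orP=> /mapP[].
  by move=> m; rewrite mem_iota /= add0n => mk ->; exists k, m, s.
move=> u /IHs[n [m [r [mn sr ur]]]] ->; exists n, m, (k :: r); split=> //.
  by rewrite -(perm_cons k) in sr; exact: perm_trans sr (perm_cons2 _ _ _).
by rewrite -(perm_cons k) in ur; exact: perm_trans ur (perm_cons2 _ _ _).
Qed.

Lemma perm_cons_moves (s r : seq nat) (n m : nat) :
  perm_eq s (n :: r) -> m < n -> exists2 t, t \in moves s & perm_eq t (m :: r).
Proof.
elim: s r => [|k s IHs] r sr mn; first by have := perm_size sr.
have [kn|kn] := eqVneq k n.
  rewrite kn perm_cons in sr; exists (m :: s); last by rewrite perm_cons.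
  by rewrite /= mem_cat map_f // mem_iota kn.
have kr : k \in r.
  by have := perm_mem sr k; rewrite !inE eqxx (negPf kn) /= => <-.
have [t ts tr] : exists2 t, t \in moves s & perm_eq t (m :: rem k r).
  apply: IHs => //; rewrite -(perm_cons k); apply: (perm_trans sr).
  apply: (perm_trans (y := n :: k :: rem k r)).
    by rewrite perm_cons perm_to_rem.
  exact: perm_cons2.
exists (k :: t); first by rewrite /= mem_cat map_f ?orbT.
apply: (perm_trans (y := k :: m :: rem k r)); first by rewrite perm_cons.
apply: (perm_trans (y := m :: k :: rem k r)).
  exact: perm_cons2.
by rewrite perm_cons perm_sym perm_to_rem.
Qed.

Lemma sumn_moves (s t : seq nat) : t \in moves s -> sumn t < sumn s.
Proof.
move=> /moves_perm_cons[n [m [r [mn /perm_sumn-> /perm_sumn->]]]] /=; lia.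
Qed.

Lemma perm_moves (s t s' : seq nat) : perm_eq s t -> s' \in moves s ->
  exists2 t', t' \in moves t & perm_eq s' t'.
Proof.
move=> st /moves_perm_cons[n [m [r [mn sr s'r]]]].
have tr : perm_eq t (n :: r) by rewrite perm_sym in st; apply: perm_trans st sr.
have [t' t't t'r] := perm_cons_moves tr mn.
by exists t' => //; rewrite (perm_trans s'r) // perm_sym.
Qed.

Lemma game_isoE (G H : game) : game_iso G H =
  all (fun G' => has (game_iso G') (options H)) (options G) &&
  all (fun H' => has (fun G' => game_iso G' H') (options G)) (options H).
Proof. by case: G. Qed.

Lemma perm_nim_iso (s t : seq nat) :
  perm_eq s t -> game_iso (nim_position s) (nim_position t).
Proof.
elim/ltn_ind: {s}(sumn s) {-2}s (erefl (sumn s)) t => k IHk s sk t st.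
have IH s' t' : s' \in moves s -> perm_eq s' t' ->
    game_iso (nim_position s') (nim_position t').
  by move=> /sumn_moves s's; apply: IHk (erefl _) _; rewrite -sk.
rewrite game_isoE; apply/andP; split; apply/allP => _ /nim_optionP[u uM ->].
  have [v vM uv] := perm_moves st uM.
  by apply/hasP; exists (nim_position v); [exact: nim_optionT | exact: IH].
rewrite perm_sym in st; have [v vM uv] := perm_moves st uM.
apply/hasP; exists (nim_position v); first exact: nim_optionT.
by apply: IH; rewrite // perm_sym.
Qed.

(** * Comparing multisets of heaps by their moves *)

(* A Nim move on multisets of positive heap sizes, the emptied heap being
   deleted. *)
Definition multiset_move (s t : seq nat) : Prop :=
  exists a b r, [/\ b < a, perm_eq s (a :: r) & perm_eq t (nseq (0 < b) b ++ r)].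

Lemma multiset_move_perm (s s' t t' : seq nat) :
  perm_eq s s' -> perm_eq t t' -> multiset_move s t -> multiset_move s' t'.
Proof.
move=> ss' tt' [a [b [r [ba sr tr]]]]; exists a, b, r; split=> //.
  by apply: perm_trans sr; rewrite perm_sym.
by apply: perm_trans tr; rewrite perm_sym.
Qed.

Lemma sumn_multiset_move (s t : seq nat) : multiset_move s t -> sumn t < sumn s.
Proof.
case=> a [b [r [ba /perm_sumn-> /perm_sumn->]]].
rewrite sumn_cat sumn_nseq /=; nia.
Qed.

Lemma size_multiset_move (s t : seq nat) :
  multiset_move s t -> size t <= size s <= (size t).+1.
Proof.
case=> a [b [r [ba /perm_size-> /perm_size->]]].
rewrite size_cat size_nseq /=; lia.
Qed.

Lemma multiset_move_rem (s : seq nat) (a b : nat) : a \in s -> b < a ->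
  multiset_move s (nseq (0 < b) b ++ rem a s).
Proof. by move=> sa ba; exists a, b, (rem a s); rewrite perm_to_rem. Qed.

(** Used with [leq] for a least heap and with [geq] for a largest one. *)
Lemma seq_extremum (leT : rel nat) (s : seq nat) :
  total leT -> transitive leT -> s != [::] ->
  exists2 k, k \in s & {in s, forall x, leT k x}.
Proof.
move=> leT_total leT_tr s0.
case sE: (sort leT s) (sort_sorted leT_total s) => [|k r].
  by have := size_sort leT s; rewrite sE; case: s s0 {sE}.
have mem_s x : (x \in s) = (x \in k :: r) by rewrite -sE mem_sort.
move=> /(order_path_min leT_tr)/allP kr; exists k; rewrite ?mem_s ?mem_head //.
move=> x; rewrite mem_s inE => /orP[/eqP->|/kr //].
by case/orP: (leT_total k k).
Qed.

(** Let [k] be the largest heap of both sides, say in [s]. Deleting it is also a move of [t], and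
    equal totals make that move remove exactly [k]. No heap of [t] exceeds [k], so it deletes a heap
    [k], and the remainders agree. *)
Lemma perm_of_same_moves (s t : seq nat) :
  0 \notin s -> 0 \notin t -> sumn s = sumn t ->
  (forall u, multiset_move s u -> multiset_move t u) ->
  (forall u, multiset_move t u -> multiset_move s u) -> perm_eq s t.
Proof.
have [->|s0] := eqVneq s [::].
  by move=> _; case: t => [//|[|x] t]; rewrite ?inE.
have [->|t0] := eqVneq t [::].
  by move=> + _ => /[swap]; case: s s0 => [//|[|x] s]; rewrite ?inE.
have [k sk kmax] := seq_extremum (leT := geq) (fun x y => leq_total y x)
  (fun x y z xy zx => leq_trans zx xy) s0.
have [l tl lmax] := seq_extremum (leT := geq) (fun x y => leq_total y x)
  (fun x y z xy zx => leq_trans zx xy) t0.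
wlog lk : s t k l s0 t0 sk kmax tl lmax / l <= k.
  move=> IH; case: (leqP l k) => [|/ltnW kl] s00 t00 e st ts.
    by move=> lk; apply: (IH s t k l).
  by rewrite perm_sym; apply: (IH t s l k).
move=> s00 t00 eqst + _.
have k0 : 0 < k by case: k sk {kmax lk} => [|//]; rewrite (negPf s00).
move=> /(_ _ (multiset_move_rem sk k0))[a [b [r [ba tr /= sr]]]].
have ak : a <= k.
  by apply: leq_trans lk; apply: lmax; rewrite (perm_mem tr) mem_head.
have := perm_sumn (perm_to_rem sk); have := perm_sumn sr.
have := perm_sumn tr; rewrite /= sumn_cat sumn_nseq => e1 e2 e3.
have b0 : b = 0 by nia.
have {}ak : a = k by nia.
subst; rewrite (perm_trans (perm_to_rem sk)) //.
by rewrite perm_sym (perm_trans tr) // perm_cons perm_sym.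
Qed.

(** With equal totals no move of [s] can be reversed to [t], so the moves coincide. With a larger
    total for [s], lowering its least heap by one yields a contradiction. *)
Lemma perm_of_irreversible_moves (s t : seq nat) :
  0 \notin s -> 0 \notin t -> t != [::] -> sumn t <= sumn s ->
  ~ multiset_move s t ->
  (forall u, multiset_move t u -> multiset_move s u) ->
  (forall u, multiset_move s u -> multiset_move t u \/ multiset_move u t) ->
  perm_eq s t.
Proof.
move=> s0 t0 tn0 le_ts nst ts st.
have [eq_ts|ne_ts] := eqVneq (sumn t) (sumn s).
  apply: perm_of_same_moves => // u su; case: (st u su) => //.
  by move/sumn_multiset_move; have := sumn_multiset_move su; lia.
have {le_ts ne_ts} lt_ts : sumn t < sumn s by rewrite ltn_neqAle ne_ts.
have sn0 : s != [::] by case: s lt_ts {s0 nst ts st}.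
have [a sa amin] := seq_extremum leq_total leq_trans sn0.
have a0 : 0 < a by case: a sa {amin} => [|//]; rewrite (negPf s0).
have a1a : a.-1 < a by lia.
have su := multiset_move_rem sa a1a.
set u := nseq _ _ ++ _ in su.
have sum_u : (sumn u).+1 = sumn s.
  rewrite (perm_sumn (perm_to_rem sa)) sumn_cat sumn_nseq /=; nia.
(* The total of [u] is one below that of [s], hence at least that of [t], so [t] cannot move to
   [u]. *)
have ut : multiset_move u t.
  by case: (st u su) => // /sumn_multiset_move; lia.
have [k tk] : exists k, k \in t.
  by case: t tn0 {t0 lt_ts nst ts st ut} => // k t _; exists k; rewrite mem_head.
have k0 : 0 < k by case: k tk => [|//]; rewrite (negPf t0).
(* Deleting a heap of [t] is a move of [s], which bounds the size of [s] by that of [t]; the path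
   from [s] through [u] to [t] gives the converse. *)
have size_st : size s = size t.
  have := size_multiset_move (ts _ (multiset_move_rem tk k0)).
  have := perm_size (perm_to_rem tk); rewrite /=.
  have := size_multiset_move su; have := size_multiset_move ut.
  rewrite /=; lia.
have size_u : size u = size s.
  by have := size_multiset_move su; have := size_multiset_move ut; lia.
have a1 : 0 < a.-1.
  have := perm_size (perm_to_rem sa); move: size_u.
  rewrite size_cat size_nseq /=; lia.
case: ut => c [d [r [dc uc tr]]].
have d0 : 0 < d.
  have := perm_size tr; have := perm_size uc.
  rewrite (size_cat (nseq (0 < d) d)) size_nseq /=; lia.
rewrite /u a1 /= in uc; rewrite d0 /= in tr.
(* If the move from [u] to [t] lowers the same heap again, then [s] reaches [t] in one move. *)
have [ca|ca] := eqVneq c a.-1.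
  case: nst; exists a, d, (rem a s); rewrite d0 perm_to_rem // (ltn_trans dc) ?ca //.
  by rewrite ca perm_cons in uc; rewrite (perm_trans tr) //= perm_cons perm_sym.
have ra : a.-1 \in r.
  have := perm_mem uc a.-1; rewrite !inE eqxx /= => /esym.
  by rewrite eq_sym (negPf ca).
(* Deleting [d] from [t] leaves [r], with one heap fewer than [s]. The matching move of [s] thus
   deletes a heap, so [a.-1] already occurs in [s], against the minimality of [a]. *)
have [x [y [q [yx sq rq]]]] : multiset_move s r.
  by apply: ts; exists d, 0, r.
have sq_a : a.-1 \in s.
  have size_q : size r = size q.
    by apply: succn_inj; rewrite -[LHS](perm_size tr) -size_st (perm_size sq).
  have y0 : (0 < y) = false.
    have /eqP := perm_size rq; rewrite size_cat size_nseq size_q.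
    by rewrite -{1}[size q]add0n eqn_add2r; case: (0 < y).
  by rewrite (perm_mem sq) inE; rewrite (perm_mem rq) y0 in ra; rewrite ra orbT.
by have := amin _ sq_a; rewrite leqNgt a1a.
Qed.

(** * Keys: halved heaps and parity *)

Definition half_heaps (s : seq nat) : seq nat := [seq k <- map half s | 0 < k].

Definition same_key (s t : seq nat) : bool :=
  perm_eq (half_heaps s) (half_heaps t) && (odd (sumn s) == odd (sumn t)).

Lemma same_key_refl : reflexive same_key.
Proof. by move=> s; rewrite /same_key perm_refl eqxx. Qed.

Lemma same_key_sym : symmetric same_key.
Proof. by move=> s t; rewrite /same_key perm_sym eq_sym. Qed.

Lemma same_key_trans : transitive same_key.
Proof.
move=> t s u /andP[st /eqP pst] /andP[tu /eqP ptu].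
by rewrite /same_key (perm_trans st tu) pst ptu eqxx.
Qed.

Lemma half_heaps_gt0 (s : seq nat) : 0 \notin half_heaps s.
Proof. by rewrite mem_filter. Qed.

Lemma perm_half_heaps (s t : seq nat) :
  perm_eq s t -> perm_eq (half_heaps s) (half_heaps t).
Proof. by move=> st; apply/perm_filter/perm_map. Qed.

Lemma half_heaps_cons (n : nat) (s : seq nat) :
  half_heaps (n :: s) = nseq (0 < n./2) n./2 ++ half_heaps s.
Proof. by rewrite /half_heaps /=; case: ifP. Qed.

Lemma sumn_half_heaps (s : seq nat) :
  sumn s = (sumn (half_heaps s)).*2 + count odd s.
Proof.
elim: s => [//|n s IHs]; rewrite half_heaps_cons sumn_cat sumn_nseq /= IHs.
have := odd_double_half n; nia.
Qed.

Lemma odd_sumn (s : seq nat) : odd (sumn s) = odd (count odd s).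
Proof. by rewrite sumn_half_heaps oddD odd_double. Qed.

Lemma perm_same_key (s t : seq nat) : perm_eq s t -> same_key s t.
Proof.
by move=> st; rewrite /same_key perm_half_heaps // (perm_sumn st) eqxx.
Qed.

(** The only moves that halving does not see lower an odd heap by one. *)
Lemma half_heaps_moves (s t : seq nat) : t \in moves s ->
  multiset_move (half_heaps s) (half_heaps t) \/
  [/\ perm_eq (half_heaps s) (half_heaps t), odd (sumn t) = ~~ odd (sumn s)
    & has odd s].
Proof.
move=> /moves_perm_cons[n [m [r [mn sr tr]]]].
have [lt_h|ge_h] := ltnP m./2 n./2.
  left; exists n./2, m./2, (half_heaps r); split=> //.
    by have := perm_half_heaps sr; rewrite half_heaps_cons (leq_trans _ lt_h).
  by have := perm_half_heaps tr; rewrite half_heaps_cons.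
have nE : n = m.+1 by lia.
have em : ~~ odd m by lia.
have hE : n./2 = m./2 by lia.
right; split.
- apply: (perm_trans (perm_half_heaps sr)).
  rewrite perm_sym; apply: (perm_trans (perm_half_heaps tr)).
  by rewrite !half_heaps_cons hE.
- by rewrite (perm_sumn sr) (perm_sumn tr) /= nE addSn /= negbK.
- by rewrite (perm_has _ sr) /= nE /= em.
Qed.

Lemma moves_half_heaps (s u : seq nat) (p : bool) :
  multiset_move (half_heaps s) u ->
  exists t, [/\ t \in moves s, perm_eq (half_heaps t) u & odd (sumn t) = p].
Proof.
case=> a [b [r [ba sr ur]]].
have /mapP[n ns aE] : a \in map half s.
  have : a \in half_heaps s by rewrite (perm_mem sr) mem_head.
  by rewrite mem_filter => /andP[].
have sn := perm_to_rem ns.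
(* Both [b.*2] and [b.*2.+1] have half [b] and lie below [n]; the added bit gives the total the
   prescribed parity. *)
set m := b.*2 + (p (+) odd (sumn (rem n s))).
have mn : m < n by rewrite /m; case: (p (+) _); lia.
have mh : m./2 = b by rewrite /m; case: (p (+) _); lia.
have [t ts tm] := perm_cons_moves sn mn; exists t; split=> //.
  apply: (perm_trans (perm_half_heaps tm)).
  rewrite perm_sym (perm_trans ur) // half_heaps_cons mh perm_cat2l perm_sym.
  rewrite -(perm_cons a) -(permPr sr) perm_sym.
  apply: (perm_trans (perm_half_heaps sn)).
  by rewrite half_heaps_cons -aE (leq_trans _ ba).
rewrite (perm_sumn tm) /= oddD /m oddD odd_double /= oddb.
by rewrite -addbA addbb addbF.
Qed.

Lemma moves_odd (s : seq nat) : has odd s ->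
  exists t, [/\ t \in moves s, perm_eq (half_heaps t) (half_heaps s)
              & odd (sumn t) = ~~ odd (sumn s)].
Proof.
case/hasP=> n ns on; have sn := perm_to_rem ns.
have n1n : n.-1 < n by lia.
have [t ts tm] := perm_cons_moves sn n1n; exists t; split=> //.
  apply: (perm_trans (perm_half_heaps tm)).
  rewrite perm_sym; apply: (perm_trans (perm_half_heaps sn)).
  by rewrite !half_heaps_cons (_ : n.-1./2 = n./2) //; lia.
rewrite (perm_sumn tm) (perm_sumn sn) /= !oddD on /=; lia.
Qed.

Lemma moves_not_same_key (s t : seq nat) : t \in moves s -> ~~ same_key s t.
Proof.
case/half_heaps_moves=> [|[_ e _]]; rewrite /same_key.
  by move/sumn_multiset_move; apply: contraL => /andP[/perm_sumn->]; rewrite ltnn.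
by rewrite e; case: odd; rewrite andbF.
Qed.

(** * Equal keys give equal outcomes in every sum *)

(* A move of [t] is matched by a move of [s], except that lowering an odd heap
   of [t] when [s] has none is reversed by lowering a second one. *)
Lemma same_key_moves (s t t' : seq nat) : same_key s t -> t' \in moves t ->
  (exists2 s', s' \in moves s & same_key s' t') \/
  (exists2 t'', t'' \in moves t' & same_key s t'').
Proof.
move=> st tt'; have /andP[hst /eqP pst] := st.
case: (half_heaps_moves tt') => [|[htt' ptt' oddt]].
  rewrite perm_sym in hst; move=> /(multiset_move_perm hst (perm_refl _)) m.
  have [s' [ss' hs' ps']] := moves_half_heaps (odd (sumn t')) m.
  by left; exists s'; rewrite // /same_key hs' ps' eqxx.
have [odds|evens] := boolP (has odd s).
  have [s' [ss' hs' ps']] := moves_odd odds; left; exists s' => //.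
  by rewrite /same_key ps' ptt' pst eqxx andbT (perm_trans hs') ?(perm_trans hst).
(* Both totals are even, so [t'] has an odd total and still contains an odd heap to lower. *)
have pt : odd (sumn t) = false.
  by rewrite -pst odd_sumn; move: evens; rewrite has_count -leqNgt leqn0 => /eqP->.
have oddt' : has odd t'.
  by move: ptt'; rewrite pt odd_sumn has_count; case: count.
have [t'' [tt'' ht'' pt'']] := moves_odd oddt'; right; exists t'' => //.
rewrite /same_key pt'' ptt' pst negbK eqxx andbT perm_sym.
by rewrite (perm_trans ht'') // perm_sym (perm_trans hst).
Qed.

Lemma half_heaps_nil_moves (s t : seq nat) : half_heaps s = [::] ->
  t \in moves s -> half_heaps t = [::] /\ odd (sumn t) = ~~ odd (sumn s).
Proof.
move=> hs /half_heaps_moves[|[+ pt _]]; rewrite hs.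
  by case=> a [b [r [_ /perm_size]]].
by rewrite perm_sym => /perm_nilP.
Qed.

Lemma odd_sumn_has (s : seq nat) : odd (sumn s) -> has odd s.
Proof. by rewrite odd_sumn has_count; case: count. Qed.

Lemma moves_nil_key (s : seq nat) : moves s = [::] -> same_key s [::].
Proof.
move=> ms; rewrite /same_key; apply/andP; split.
  apply/perm_nilP; case hs: (half_heaps s) (half_heaps_gt0 s) => [//|a r].
  rewrite inE negb_or eq_sym -lt0n => /andP[a0 _].
  have ha : a \in half_heaps s by rewrite hs mem_head.
  have [t [+ _ _]] := moves_half_heaps true (multiset_move_rem ha a0).
  by rewrite ms.
rewrite eqbF_neg; apply/negP=> /odd_sumn_has/moves_odd[t [+ _ _]].
by rewrite ms.
Qed.

(** Induction on [X], then on the total size. Moves in [X] carry over directly, and moves in [t] are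
    either matched in [s] or reversed to a position with the key of [s]. *)
Lemma next_loses_same_key (s t : seq nat) (X : game) : same_key s t ->
  ~~ misere_next_wins (game_add (nim_position s) X) ->
  ~~ misere_next_wins (game_add (nim_position t) X).
Proof.
elim/game_options_ind: X s t => X IHX s t.
have [k] := ubnP (sumn s + sumn t); elim: k s t => // k IHk s t le_k st sX.
have {k le_k}IHk s' t' : sumn s' + sumn t' < sumn s + sumn t ->
    same_key s' t' -> ~~ misere_next_wins (game_add (nim_position s') X) ->
    ~~ misere_next_wins (game_add (nim_position t') X).
  by move=> lt_k; apply: IHk; apply: leq_trans lt_k le_k.
apply: next_loses_add => [|_ /nim_optionP[t' tt' ->]|X' XX'].
(* If the sum with [t] is over, [s] consists of an even number of heaps of size one, besides empty
   ones. Either [s] has no move, or two moves lead to a smaller position with the same key, where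
   the induction hypothesis applies. *)
- apply/negP=> tX_end; have /andP[/nilP t0 /nilP X0] := tX_end.
  have {}t0 : moves t = [::].
    by move: t0; rewrite options_nim_position; case: (moves t).
  have /andP[/perm_nilP ht /eqP pt] := moves_nil_key t0.
  have /andP[hst /eqP ps] := st.
  have {hst}/perm_nilP hs : perm_eq (half_heaps s) [::] by rewrite -ht.
  rewrite /= in pt; rewrite pt in ps.
  case ms: (moves s) => [|s' ms'].
    by move: sX; rewrite misere_next_wins_add options_nim_position ms X0.
  have ss' : s' \in moves s by rewrite ms mem_head.
  have [hs' ps'] := half_heaps_nil_moves hs ss'.
  have : misere_next_wins (game_add (nim_position s') X).
    by apply: contraNT sX; apply/next_wins_addl/nim_optionT.
  rewrite misere_next_wins_add X0 /= orbF andbT => /orP[|/hasP[G]].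
    have [|s'' [s's'' _ _]] := @moves_odd s'; first by rewrite odd_sumn_has ?ps' ?ps.
    by rewrite options_nim_position; case: (moves s') s's''.
  case/nim_optionP=> u s'u -> uX.
  have [hu pu] := half_heaps_nil_moves hs' s'u.
  have : ~~ misere_next_wins (game_add (nim_position t) X).
    apply: IHk uX.
      by rewrite ltn_add2r (ltn_trans (sumn_moves s'u)) // sumn_moves.
    by rewrite /same_key hu ht pu ps' ps pt.
  by rewrite misere_next_wins_add tX_end.
- have [[s' ss' s't']|[t'' t't'' st'']] := same_key_moves st tt'.
    apply: contraNT sX => t'X; apply: (next_wins_addl (nim_optionT ss')).
    apply: IHk t'X; last by rewrite same_key_sym.
    by rewrite addnC -addSn leq_add ?sumn_moves // ltnW ?sumn_moves.
  apply: (next_wins_addl (nim_optionT t't'')); apply: IHk sX => //.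
  by rewrite ltn_add2l (ltn_trans (sumn_moves t't'')) ?sumn_moves.
- apply: contraNT sX => tX'; apply: (next_wins_addr XX').
  by apply: IHX tX'; rewrite // same_key_sym.
Qed.

Lemma next_wins_same_key (s t : seq nat) (X : game) : same_key s t ->
  misere_next_wins (game_add (nim_position s) X) =
  misere_next_wins (game_add (nim_position t) X).
Proof.
move=> st; apply/idP/idP; apply: contraTT; apply: next_loses_same_key => //.
by rewrite same_key_sym.
Qed.

Lemma distinguished_same_key (s s' t t' : seq nat) :
  same_key s s' -> same_key t t' ->
  distinguished (nim_position s') (nim_position t') ->
  distinguished (nim_position s) (nim_position t).
Proof.
move=> ss' tt' [X]; exists X.
by rewrite (next_wins_same_key X ss') (next_wins_same_key X tt').
Qed.

(** * Different keys are distinguished *)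

(** Rounds every heap down to an even size and stores the parity of the total in one extra heap of
    size 0 or 1. *)
Definition canonical_nim (s : seq nat) : seq nat :=
  nat_of_bool (odd (sumn s)) :: [seq k.*2 | k <- map half s].

Lemma canonical_nimP (s : seq nat) :
  [/\ same_key (canonical_nim s) s, count odd (canonical_nim s) <= 1
    & sumn (canonical_nim s) <= sumn s].
Proof.
have count0 : count odd [seq k.*2 | k <- map half s] = 0.
  rewrite count_map (eq_count (a2 := pred0)) ?count_pred0 // => k /=.
  by rewrite odd_double.
have half_canonical : half_heaps (canonical_nim s) = half_heaps s.
  rewrite /canonical_nim half_heaps_cons /half_heaps (mapK doubleK).
  by case: odd.
have cs : count odd (canonical_nim s) = odd (sumn s).
  by rewrite /canonical_nim /= count0 addn0 oddb.
split.
- by rewrite /same_key half_canonical perm_refl odd_sumn cs oddb eqxx.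
- by rewrite cs leq_b1.
- rewrite (sumn_half_heaps (canonical_nim s)) (sumn_half_heaps s) half_canonical.
  rewrite leq_add2l cs odd_sumn.
  by case: count => [//|c]; case: odd.
Qed.

Lemma odd_sumn_hasE (s : seq nat) : count odd s <= 1 -> has odd s = odd (sumn s).
Proof. by rewrite odd_sumn has_count; case: count => [|[|]]. Qed.

(** The combinatorial core: option matching descends to the halved heaps, where
    [perm_of_irreversible_moves] applies unless [half_heaps t] is empty. That case is settled by
    hand and produces the exception. *)
Lemma same_key_of_options (s t : seq nat) :
  count odd s <= 1 -> count odd t <= 1 -> sumn t <= sumn s ->
  (forall t', t' \in moves t -> exists2 s', s' \in moves s & same_key s' t') ->
  (forall s', s' \in moves s ->
    (exists2 t', t' \in moves t & same_key t' s') \/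
    (exists2 s'', s'' \in moves s' & same_key s'' t)) ->
  same_key s t \/ same_key s [:: 2; 2] /\ same_key t [::].
Proof.
move=> cs ct le_ts ts st.
have odd_s := odd_sumn_hasE cs; have odd_t := odd_sumn_hasE ct.
(* Otherwise the matching of [s'] would give a position with the same key as one of its own
   options. *)
have not_option s' : s' \in moves s -> ~~ same_key s' t.
  move=> ss'; apply/negP=> s't; case: (st _ ss') => [[u tu us']|[u s'u ut]].
    have := moves_not_same_key tu; rewrite same_key_sym.
    by rewrite (same_key_trans us' s't).
  have := moves_not_same_key s'u; rewrite same_key_sym in ut.
  by rewrite (same_key_trans s't ut).
have not_move : ~ multiset_move (half_heaps s) (half_heaps t).
  move=> /(moves_half_heaps (odd (sumn t)))[s' [ss' hs' ps']].
  by have := not_option _ ss'; rewrite /same_key hs' ps' eqxx.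
(* Only parity is left. If [s] alone had an odd heap, lowering it would give an option with the key
   of [t]; if [t] alone had one, its total would be the larger. *)
have perm_done : perm_eq (half_heaps s) (half_heaps t) -> same_key s t.
  move=> hst; rewrite /same_key hst /=; case pt: (odd (sumn t)).
    have : count odd t <= count odd s.
      move: le_ts; rewrite (sumn_half_heaps s) (sumn_half_heaps t).
      by rewrite (perm_sumn hst) leq_add2l.
    rewrite odd_sumn in pt; rewrite odd_sumn.
    by case: (count odd t) ct pt => [|[|]] //; case: (count odd s) cs => [|[|]].
  case ps: (odd (sumn s)) => //.
  have [|s' [ss' hs' ps']] := @moves_odd s; first by rewrite odd_s.
  by have := not_option _ ss'; rewrite /same_key (perm_trans hs' hst) ps' ps pt.
have move_ts u : multiset_move (half_heaps t) u -> multiset_move (half_heaps s) u.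
  (* The option is taken with odd total, because lowering the only odd heap of [s] gives an even
     total and so cannot be its match. *)
  move=> /(moves_half_heaps true)[t' [tt' ht' pt']].
  have [s' ss' /andP[hs't' /eqP ps't']] := ts _ tt'.
  case: (half_heaps_moves ss') => [|[_ ps' os]].
    exact: multiset_move_perm (perm_refl _) (perm_trans hs't' ht').
  by move: ps'; rewrite ps't' pt' -odd_s os.
have move_st u : multiset_move (half_heaps s) u ->
    multiset_move (half_heaps t) u \/ multiset_move u (half_heaps t).
  move=> su; have [s' [ss' hs' _]] := moves_half_heaps true su.
  have ut_absurd : ~~ perm_eq u (half_heaps t).
    apply/negP=> ut; apply: not_move.
    exact: multiset_move_perm (perm_refl _) ut su.
  case: (st _ ss') => [[t' tt' /andP[ht's' _]]|[s'' s's'' /andP[hs''t _]]].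
    have ht'u := perm_trans ht's' hs'.
    case: (half_heaps_moves tt') => [|[htt' _ _]].
      by left; apply: multiset_move_perm (perm_refl _) ht'u _.
    by case/negP: ut_absurd; rewrite perm_sym (perm_trans htt').
  case: (half_heaps_moves s's'') => [|[hs's'' _ _]].
    by right; apply: multiset_move_perm hs' hs''t _.
  case/negP: ut_absurd; rewrite perm_sym in hs'.
  by rewrite (perm_trans hs') ?(perm_trans hs's'').
have [ht|ht] := eqVneq (half_heaps t) [::]; last first.
  left; apply: perm_done.
  apply: perm_of_irreversible_moves => //; rewrite ?half_heaps_gt0 //.
  move: le_ts; rewrite (sumn_half_heaps s) (sumn_half_heaps t); lia.
case pt: (odd (sumn t)).
  have [|t' [tt' ht' pt']] := @moves_odd t; first by rewrite odd_t.
  have [s' ss' /andP[hs't' _]] := ts _ tt'.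
  have hs't := perm_trans hs't' ht'.
  case: (half_heaps_moves ss') => [sm|[hss' _ _]].
    by case: not_move; apply: multiset_move_perm (perm_refl _) hs't sm.
  by left; apply/perm_done/(perm_trans hss').
have t0 : same_key t [::] by rewrite /same_key ht pt.
(* As [half_heaps t] is empty, [u] is not a move of it and must itself reach the empty multiset in
   one move. Lowering heaps of [s] by one then forces the halves to be 1 and 1. *)
have single u : multiset_move (half_heaps s) u -> size u = 1.
  move=> /move_st; rewrite ht => -[].
    by case=> a [b [r [_ /perm_size]]].
  case=> a [b [r [_ /perm_size-> /perm_size]]].
  by rewrite size_cat /=; lia.
case hs: (half_heaps s) => [|a r]; first by left; apply: perm_done; rewrite hs ht.
have := half_heaps_gt0 s; rewrite hs inE negb_or eq_sym -lt0n => /andP[a0 r0].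
case rE: r r0 => [|b r'].
  case: not_move; exists a, 0, [::]; split; rewrite // ?ht //.
  by rewrite hs rE.
rewrite inE negb_or eq_sym -lt0n => /andP[b0 _].
have szE : size (nseq (0 < a.-1) a.-1 ++ r) = 1.
  by apply: single; exists a, a.-1, r; rewrite hs; split=> //; lia.
rewrite size_cat size_nseq rE /= in szE.
have r'0 : r' = [::] by case: r' rE szE => // c r' _ /=; lia.
have a1 : a = 1 by move: szE; case: a a0 {hs} => [|[|a]] //=; rewrite r'0.
have szE2 : size (nseq (0 < b.-1) b.-1 ++ [:: a]) = 1.
  apply: single; exists b, b.-1, [:: a]; rewrite hs rE r'0 perm_cons2.
  by split=> //; lia.
rewrite size_cat size_nseq /= in szE2.
have b1 : b = 1 by move: szE2; case: b b0 {hs rE} => [|[|b]].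
right; split=> //; rewrite /same_key hs rE r'0 a1 b1 /= eqbF_neg.
(* With an odd total, lowering the odd heap leaves two positive halves: too many to match an option
   of [t], or to be cleared by one further move. *)
apply/negP=> ps.
have [|s' [ss' hs' ps']] := @moves_odd s; first by rewrite odd_s.
have szs' := perm_size hs'; rewrite hs rE r'0 /= in szs'.
case: (st _ ss') =>
  [[t' tt' /andP[/perm_size szt' _]]|[s'' s's'' /andP[/perm_size szs'' _]]].
  have [ht' _] := half_heaps_nil_moves ht tt'.
  by move: szt'; rewrite ht' szs'.
rewrite ht in szs''.
case: (half_heaps_moves s's'') => [/size_multiset_move|[/perm_size]].
  by rewrite szs' szs''.
by rewrite szs' szs''.
Qed.

(** Induction on the total size. An option that is neither matched nor reversible gives a
    distinguishing game through [by_option]; if there is none, [same_key_of_options] applies. *)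
Lemma not_same_key_distinguished (s t : seq nat) : ~~ same_key s t ->
  distinguished (nim_position s) (nim_position t).
Proof.
have [k] := ubnP (sumn s + sumn t); elim: k s t => // k IHk s t le_k.
wlog cs : s t le_k / count odd s <= 1 /\ count odd t <= 1.
  move=> IH; have [ss cs les] := canonical_nimP s.
  have [tt ct let_] := canonical_nimP t.
  move=> nst; apply: (distinguished_same_key (s' := canonical_nim s)
    (t' := canonical_nim t)); rewrite 1?same_key_sym //.
  apply: IH => //; first by apply: leq_trans le_k; rewrite ltnS leq_add.
  apply: contra nst => cst.
  by rewrite same_key_sym in ss; rewrite (same_key_trans ss) ?(same_key_trans cst).
wlog le_ts : s t le_k cs / sumn t <= sumn s.
  move=> IH; case: (leqP (sumn t) (sumn s)); first exact: IH.
  move/ltnW => le_st nst; apply/distinguished_sym/IH => //.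
  - by rewrite addnC.
  - by case: cs.
  - by rewrite same_key_sym.
have by_option (a b b' : seq nat) : sumn a + sumn b < k.+1 -> b' \in moves b ->
    {in moves a, forall a', ~~ same_key a' b'} ->
    {in moves b', forall b'', ~~ same_key b'' a} ->
    distinguished (nim_position a) (nim_position b).
  move=> le_ab bb' aN b'N; apply: (linked_option_distinguished (nim_optionT bb')).
  have lt_b := sumn_moves bb'.
  apply: linked_if_distinguished => _ /nim_optionP[u uM ->]; apply: IHk.
  - by have := sumn_moves uM; lia.
  - exact: aN.
  - by have := sumn_moves uM; lia.
  - exact: b'N.
move=> nst; case: cs => cs ct.
case tE: (all (fun t' => has (same_key^~ t') (moves s) ||
                         has (same_key^~ s) (moves t')) (moves t)); last first.
  have /allPn[t' tt'] := negbT tE; rewrite negb_or => /andP[/hasPn ns /hasPn nt'].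
  exact: by_option le_k tt' ns nt'.
case sE: (all (fun s' => has (same_key^~ s') (moves t) ||
                         has (same_key^~ t) (moves s')) (moves s)); last first.
  have /allPn[s' ss'] := negbT sE; rewrite negb_or => /andP[/hasPn nt /hasPn ns'].
  by apply/distinguished_sym/(by_option _ _ _ _ ss' nt ns'); rewrite addnC.
case: (@same_key_of_options s t) => // [t' tt'|s' ss'| |].
- case/orP: (allP tE _ tt') => /hasP[] //; first by move=> s'; exists s'.
  (* A reversal would give [t''] the key of [s] with a total below that of [s], but with at most one
     odd heap [s] has the least total for its key. *)
  move=> t'' t't'' t''s; exfalso.
  have := sumn_moves t't''; have := sumn_moves tt'.
  move: t''s le_ts => /andP[/perm_sumn ht /eqP]; rewrite !odd_sumn.
  rewrite (sumn_half_heaps s) (sumn_half_heaps t'') ht.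
  case: (count odd s) cs => [|[|//]] _; case: (count odd t'') => //=; lia.
- by case/orP: (allP sE _ ss') => /hasP[u]; [left|right]; exists u.
- by rewrite (negPf nst).
- case=> s22 t00; apply: (distinguished_same_key s22 t00).
  (* By computation, the player to move loses 2 + 2 and wins at zero. *)
  by exists zero_game.
Qed.

(** * Reduced forms are determined by their key *)

Record reduced (r : seq nat) : Prop := Reduced {
  reduced_heap_gt0 : 0 \notin r;
  reduced_odd : count odd r <= 1;
  reduced_max : {in r & , forall a b, odd a -> b <= a}
}.

Lemma perm_map_half (r s : seq nat) : ~~ has odd r -> ~~ has odd s ->
  0 \notin r -> 0 \notin s ->
  perm_eq (half_heaps r) (half_heaps s) -> perm_eq r s.
Proof.
have key u : ~~ has odd u -> 0 \notin u -> map double (half_heaps u) = u.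
  elim: u => [//|n u IHu] /=; rewrite negb_or inE negb_or.
  move=> /andP[en eu] /andP[n0 u0].
  rewrite half_heaps_cons map_cat IHu //.
  by rewrite (_ : 0 < n./2) /=; [congr (_ :: _); lia | lia].
by move=> er es r0 s0 rs; rewrite -(key r) // -(key s) // perm_map.
Qed.

(** The odd heap is a largest one, so its half is the maximum of the halved heaps and can be read
    off the key. *)
Lemma reduced_split (r : seq nat) : reduced r -> odd (sumn r) ->
  exists q, [/\ perm_eq r ((\max_(k <- half_heaps r) k).*2.+1 :: q),
    ~~ has odd q & 0 \notin q].
Proof.
case=> r0 r1 rmax; rewrite -odd_sumn_hasE // => /hasP[a ra oa].
have rq := perm_to_rem ra; exists (rem a r).
have -> : \max_(k <- half_heaps r) k = a./2.
  apply/eqP; rewrite eqn_leq; apply/andP; split.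
    rewrite big_filter; apply/bigmax_leqP_seq => _ /mapP[b rb ->] _.
    by rewrite half_leq // rmax.
  (* For [a] equal to 1 the half is 0 and is absent from [half_heaps r], but the bound is then
     trivial. *)
  have [->//|a2] := posnP a./2.
  by apply: (leq_bigmax_seq (F := id) a./2) => //; rewrite mem_filter a2 map_f.
rewrite (_ : a./2.*2.+1 = a); last by lia.
split=> //; last by apply: contra r0 => /mem_rem.
by move: r1; rewrite (permP rq) /= oa has_count -leqNgt; case: count.
Qed.

(** Once the odd heap fixed by the key is split off, doubling the halves recovers the even heaps. *)
Lemma reduced_perm (r s : seq nat) :
  reduced r -> reduced s -> same_key r s -> perm_eq r s.
Proof.
move=> rr rs /andP[hrs /eqP prs].
have mrs : \max_(k <- half_heaps r) k = \max_(k <- half_heaps s) k.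
  exact: perm_big.
case: (boolP (odd (sumn r))) (prs) => [pr ps|pr ps].
  have [q [rq eq0 q0]] := reduced_split rr pr.
  have [p [sp ep0 p0]] := reduced_split rs (esym ps).
  rewrite mrs in rq.
  rewrite (perm_trans rq) // perm_sym (perm_trans sp) // perm_cons.
  apply: perm_map_half => //; rewrite perm_sym.
  have := perm_half_heaps rq; rewrite perm_sym half_heaps_cons.
  move=> /perm_trans/(_ hrs)/perm_trans/(_ (perm_half_heaps sp)).
  by rewrite half_heaps_cons perm_cat2l.
case: rr rs => r0 r1 _ [s0 s1 _]; apply: perm_map_half => //.
  by rewrite odd_sumn_hasE.
by rewrite odd_sumn_hasE // -ps.
Qed.

Lemma pred_odd (a : nat) : odd a -> a.-1./2 = a./2 /\ odd a.-1 = false.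
Proof. lia. Qed.

(** Lowering two odd heaps keeps their halves and changes the total by two. Counting a loss of only
    one odd heap per round suffices for [count odd s] rounds. *)
Lemma lower_odd_pairP (s : seq nat) :
  same_key (lower_odd_pair s) s /\
  count odd (lower_odd_pair s) <= maxn 1 (count odd s).-1.
Proof.
rewrite /lower_odd_pair; case sE: (sort leq (filter odd s)) => [|a [|b q]].
- split; first exact: same_key_refl.
  by rewrite leq_max -size_filter -(size_sort leq) sE.
- split; first exact: same_key_refl.
  by rewrite leq_max -size_filter -(size_sort leq) sE.
have pE : perm_eq (filter odd s) [:: a, b & q] by rewrite -sE perm_sym perm_sort.
have [oa sa] : odd a /\ a \in s.
  by apply/andP; rewrite -mem_filter (perm_mem pE) mem_head.
have sa_perm := perm_to_rem sa.
have ra : perm_eq (filter odd (rem a s)) (b :: q).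
  rewrite -(perm_cons a) perm_sym -(permPl pE).
  by have := perm_filter odd sa_perm; rewrite /= oa.
have [ob sb] : odd b /\ b \in rem a s.
  by apply/andP; rewrite -mem_filter (perm_mem ra) mem_head.
have sE2 : perm_eq s [:: a, b & rem b (rem a s)].
  by rewrite (perm_trans sa_perm) // perm_cons perm_to_rem.
split; last first.
  rewrite (permP sE2) /= oa ob; lia.
rewrite same_key_sym; apply: (same_key_trans (perm_same_key sE2)).
have [ha pa] := pred_odd oa; have [hb pb] := pred_odd ob.
rewrite /same_key !half_heaps_cons ha hb perm_refl /= !oddD oa ob pa pb.
by case: odd.
Qed.

Lemma lower_odd_pairsP (s : seq nat) :
  same_key (lower_odd_pairs s) s /\ count odd (lower_odd_pairs s) <= 1.
Proof.
rewrite /lower_odd_pairs.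
have iterP n : same_key (iter n lower_odd_pair s) s /\
    count odd (iter n lower_odd_pair s) <= maxn 1 (count odd s - n).
  elim: n => [|n [keyn cn]] /=; first by rewrite same_key_refl; lia.
  have [key1 c1] := lower_odd_pairP (iter n lower_odd_pair s).
  split; first exact: same_key_trans key1 keyn.
  by lia.
by have [-> ] := iterP (count odd s); rewrite subnn.
Qed.

Lemma filter_reduced_key (s : seq nat) :
  same_key [seq n <- s | 0 < n] s.
Proof.
rewrite /same_key /half_heaps; apply/andP; split.
  elim: s => [//|[|n] s IHs] //=; by case: ifP => // _; rewrite perm_cons.
by apply/eqP; elim: s => [//|[|n] s IHs] //=; rewrite !oddD IHs.
Qed.

Lemma shift_odd_heapP (s : seq nat) : count odd s <= 1 ->
  [/\ same_key (shift_odd_heap s) s, count odd (shift_odd_heap s) <= 1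
    & {in shift_odd_heap s &, forall a b, odd a -> b <= a}].
Proof.
move=> cs; rewrite /shift_odd_heap; set m := \max_(n <- s) n.
have le_m b : b \in s -> b <= m by move=> sb; apply: (leq_bigmax_seq (F := id) b).
case sE: (filter odd s) => [|a q].
  split=> //; first exact: same_key_refl.
  move=> a b sa _ oa; have : a \in filter odd s by rewrite mem_filter oa.
  by rewrite sE.
have q0 : q = [::].
  by move: cs; rewrite -size_filter sE /=; case: q {sE}.
rewrite q0 in sE.
have odd_eq x : x \in s -> odd x -> x = a.
  move=> sx ox; have : x \in filter odd s by rewrite mem_filter ox.
  by rewrite sE inE => /eqP.
case: ltnP => [lt_am|le_ma]; last first.
  split=> //; first exact: same_key_refl.
  by move=> x b sx sb /(odd_eq _ sx)->; apply: leq_trans le_ma; apply: le_m.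
have [oa sa] : odd a /\ a \in s.
  by apply/andP; rewrite -mem_filter sE mem_head.
have sm : m \in s.
  have sn0 : s != [::] by case: s sa {cs m le_m sE odd_eq lt_am}.
  have [k sk kmax] := seq_extremum (leT := geq) (fun x y => leq_total y x)
    (fun x y z xy zx => leq_trans zx xy) sn0.
  rewrite (_ : m = k) //; apply/eqP; rewrite eqn_leq le_m // andbT.
  by apply/bigmax_leqP_seq => x sx _; apply: kmax.
(* As [a] is the only odd heap, the larger [m] is even, so [m.+1] has the same half as [m]. *)
have em : ~~ odd m by apply/negP=> /(odd_eq _ sm) am; rewrite am ltnn in lt_am.
have sa_perm := perm_to_rem sa.
have rm : m \in rem a s.
  by have := sm; rewrite (perm_mem sa_perm) inE => /orP[/eqP ma|//]; lia.
have sE2 : perm_eq s [:: a, m & rem m (rem a s)].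
  by rewrite (perm_trans sa_perm) // perm_cons perm_to_rem.
have er : ~~ has odd (rem m (rem a s)).
  by move: cs; rewrite (permP sE2) /= oa has_count -leqNgt; lia.
split.
- rewrite same_key_sym; apply: (same_key_trans (perm_same_key sE2)).
  rewrite /same_key !half_heaps_cons (_ : a.-1./2 = a./2); last by lia.
  rewrite (_ : m.+1./2 = m./2); last by lia.
  by rewrite perm_refl /=; lia.
- have : count odd (rem m (rem a s)) = 0.
    by move: er; rewrite has_count -leqNgt leqn0 => /eqP.
  by rewrite /= => ->; lia.
move=> x b; rewrite !inE => /or3P[/eqP->|/eqP->|xr] bt ox; first lia.
  case/or3P: bt => [/eqP->|/eqP->|/mem_rem/mem_rem/le_m]; lia.
by case/negP: er; apply/hasP; exists x.
Qed.

Lemma nim_reduced_formP (s : seq nat) :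
  same_key (nim_reduced_form s) s /\ reduced (nim_reduced_form s).
Proof.
have [key1 c1] := lower_odd_pairsP s.
have [key2 c2 max2] := shift_odd_heapP c1.
rewrite /nim_reduced_form; set r := shift_odd_heap _ in key2 c2 max2 *.
split; first exact: same_key_trans (filter_reduced_key r) (same_key_trans key2 key1).
split; first by rewrite mem_filter.
  by apply: leq_trans c2; rewrite count_filter; apply: sub_count => x /andP[].
move=> a b; rewrite !mem_filter => /andP[_ ra] /andP[_ rb]; exact: max2.
Qed.

Theorem theorem6 (s t : seq nat) :
  misere_equiv (nim_position s) (nim_position t) ->
  game_iso (nim_position (nim_reduced_form s))
           (nim_position (nim_reduced_form t)).
Proof.
move=> eq_st.
have key_st : same_key s t.
  apply/negPn/negP=> /not_same_key_distinguished.
  exact: misere_equiv_not_distinguished.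
have [ks rs] := nim_reduced_formP s; have [kt rt] := nim_reduced_formP t.
apply/perm_nim_iso/reduced_perm => //; apply: (same_key_trans ks).
by rewrite (same_key_trans key_st) // same_key_sym.
Qed.
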